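(* Let $p$ be prime and, for $n\ge1$, let $N=p^n$ and $\sigma_n\sim\mathrm{Unif}(B_{s,n}^{(p)})$. Then $C(\sigma_n)\sim\frac Np\left(1+(p-1)\,\xi_N\right)$ in distribution, where $\xi_N\sim\mathrm{Bern}(\frac1N)$, and $\frac pN C(\sigma_n)$ converges in probability to $1$ as $n\to\infty$.
   Context: $C(\sigma)$ is the number of cycles in the disjoint cycle decomposition of $\sigma$ (fixed points counted as cycles). $\mathrm{Bern}(q)$ is the Bernoulli distribution with success probability $q$. For permutations $\sigma\in S_a,\tau\in S_b$, $\sigma\otimes\tau\in S_{ab}$ is the permutation with $P_{\sigma\otimes\tau}=P_\sigma\otimes P_\tau$ (Kronecker product), where $P_\sigma\mathbf e_k=\mathbf e_{\sigma(k)}$. With $\tau_p=(1\ 2\ \cdots\ p)\in S_p$, the group of simple $p$-nary butterfly permutations is $B_{s,n}^{(p)}=\{\sigma_1\otimes\cdots\otimes\sigma_n:\sigma_j\in\langle\tau_p\rangle\}\subset S_{p^n}$. *)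

(* Defs.v *)
From HB Require Import structures.
From mathcomp Require Import all_boot all_order all_algebra all_fingroup.
From mathcomp Require Import all_classical all_reals all_analysis.
From mathcomp Require Import mxtens.

Set Implicit Arguments.
Unset Strict Implicit.
Unset Printing Implicit Defensive.

Import Order.TTheory GRing.Theory Num.Theory GroupScope.
Import numFieldNormedType.Exports.
Local Open Scope classical_set_scope.
Local Open Scope ring_scope.

(* The number of cycles, fixed points included: [porbits s] is the set of all
   orbits of <[s]>, singletons among them. *)
Definition ncycles (m : nat) (s : {perm 'I_m}) : nat := #|porbits s|.

(* [P_s e_k = e_(s k)] on column vectors; MathComp's [perm_mx] uses the row
   vector convention, whence the transpose. *)
Definition pmatrix (R : nzRingType) (m : nat) (s : {perm 'I_m}) : 'M[R]_m :=
  (perm_mx s)^T.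

Lemma pmatrix_delta (R : nzRingType) (m : nat) (s : {perm 'I_m}) (k : 'I_m) :
  pmatrix R s *m (delta_mx k 0 : 'cV_m) = delta_mx (s k) 0.
Proof.
apply/matrixP => i j; rewrite ord1 mxE (bigD1 k) //= big1 => [|l lk].
  by rewrite !mxE !eqxx mulr1 addr0 andbT eq_sym.
by rewrite !mxE (negPf lk) mulr0.
Qed.

(* [mxtens_index (i, j)] has value [i * b + j]: the index order of Kronecker
   products. *)
Definition kron_fun (a b : nat) (s : {perm 'I_a}) (t : {perm 'I_b})
    (k : 'I_(a * b)) : 'I_(a * b) :=
  mxtens_index (s (mxtens_unindex k).1, t (mxtens_unindex k).2).

Lemma kron_fun_inj (a b : nat) (s : {perm 'I_a}) (t : {perm 'I_b}) :
  injective (kron_fun s t).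
Proof.
move=> k l /(can_inj (@mxtens_indexK a b)) e.
apply: (can_inj (@mxtens_unindexK a b)).
have /perm_inj e1 := congr1 fst e; have /perm_inj e2 := congr1 snd e.
exact: (congr2 pair e1 e2).
Qed.

Definition kron_perm (a b : nat) (s : {perm 'I_a}) (t : {perm 'I_b}) :
  {perm 'I_(a * b)} := perm (@kron_fun_inj a b s t).

Lemma pmatrix_kron (R : nzRingType) (a b : nat)
    (s : {perm 'I_a}) (t : {perm 'I_b}) :
  pmatrix R (kron_perm s t) = tensmx (pmatrix R s) (pmatrix R t).
Proof.
apply/matrixP => i j.
case: (mxtens_indexP i) => i1 i2; case: (mxtens_indexP j) => j1 j2.
rewrite tensmxE !mxE permE /kron_fun mxtens_indexK.
rewrite (can_eq (@mxtens_indexK a b)) xpair_eqE -natrM.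
by case: (_ == _); case: (_ == _).
Qed.

(* [s 0 (x) s 1 (x) ... (x) s (n - 1)], the identity of S_1 if [n = 0]; the
   cast only adjusts the type along [p * p ^ n' = p ^ n'.+1]. *)
Fixpoint kron_prod (p n : nat) : ('I_n -> {perm 'I_p}) -> {perm 'I_(p ^ n)} :=
  match n with
  | 0%N => fun _ => 1%g
  | n'.+1 => fun s =>
      cast_perm (esym (expnS p n'))
        (kron_perm (s ord0) (kron_prod (fun j => s (lift ord0 j))))
  end.

(* The cycle (1 2 ... p), indices shifted to {0, ..., p - 1}. *)
Definition tau (p : nat) : {perm 'I_p} := perm (@ordS_inj p).

Definition butterfly (p n : nat) : {set {perm 'I_(p ^ n)}} :=
  [set kron_prod (s : {ffun 'I_n -> {perm 'I_p}})
     | s : {ffun 'I_n -> {perm 'I_p}} & [forall j, s j \in <[tau p]>%g]]%SET.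

Lemma kron_perm1 (a b : nat) : @kron_perm a b 1%g 1%g = 1%g.
Proof.
apply/permP => k; rewrite !permE /kron_fun !perm1 -surjective_pairing.
exact: mxtens_unindexK.
Qed.

Lemma kron_permM (a b : nat) (s s' : {perm 'I_a}) (t t' : {perm 'I_b}) :
  kron_perm (s * s')%g (t * t')%g = (kron_perm s t * kron_perm s' t')%g.
Proof.
by apply/permP => k; rewrite permM !permE /kron_fun mxtens_indexK !permM.
Qed.

Lemma cast_permM (m n : nat) (e : m = n) (s t : {perm 'I_m}) :
  cast_perm e (s * t)%g = (cast_perm e s * cast_perm e t)%g.
Proof. by subst n; rewrite !cast_perm_id. Qed.

Lemma eq_kron_prod (p n : nat) (s t : 'I_n -> {perm 'I_p}) :
  s =1 t -> kron_prod s = kron_prod t.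
Proof. by move=> /funext ->. Qed.

Lemma kron_prod1 (p n : nat) : kron_prod (fun _ : 'I_n => 1%g : {perm 'I_p}) = 1%g.
Proof.
elim: n => [|n IHn] //=; rewrite IHn kron_perm1.
by apply/permP => k; rewrite cast_permE !perm1 cast_ordKV.
Qed.

Lemma kron_prodM (p n : nat) (s t : 'I_n -> {perm 'I_p}) :
  kron_prod (fun j => s j * t j)%g = (kron_prod s * kron_prod t)%g.
Proof.
elim: n s t => [|n IHn] s t /=; first by rewrite mulg1.
by rewrite IHn kron_permM cast_permM.
Qed.

Lemma butterfly_group_set (p n : nat) : group_set (butterfly p n).
Proof.
apply/group_setP; split=> [|x y].
  apply/imsetP; exists [ffun=> 1%g].
    by rewrite inE; apply/forallP => j; rewrite ffunE group1.
  by rewrite -(kron_prod1 p n); apply: eq_kron_prod => j; rewrite ffunE.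
move=> /imsetP[s]; rewrite inE => /forallP sB ->.
move=> /imsetP[t]; rewrite inE => /forallP tB ->.
apply/imsetP; exists [ffun j => (s j * t j)%g].
  by rewrite inE; apply/forallP => j; rewrite ffunE groupM ?sB ?tB.
by rewrite -kron_prodM; apply: eq_kron_prod => j; rewrite ffunE.
Qed.

Canonical butterfly_group (p n : nat) := Group (butterfly_group_set p n).

(* Permutations carry the discrete sigma-algebra. *)
HB.instance Definition _ (T : finType) := isPointed.Build (perm_type T) 1%g.
HB.instance Definition _ (T : finType) :=
  @isMeasurable.Build default_measure_display (perm_type T)
    discrete_measurable discrete_measurable0
    discrete_measurableC discrete_measurableU.

Definition uniform_on (d : measure_display) (T : measurableType d)
    (R : realType) (P : probability T R) (m : nat)
    (X : {RV P >-> {perm 'I_m}}) (B : {set {perm 'I_m}}) : Prop :=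
  forall s : {perm 'I_m},
    distribution P X [set s] = (if s \in B then #|B|%:R^-1 else 0)%:E.

Definition eq_law (d1 d2 : measure_display) (T1 : measurableType d1)
    (T2 : measurableType d2) (R : realType) (P : probability T1 R)
    (Q : probability T2 R) (X : T1 -> R) (Y : T2 -> R) : Prop :=
  [/\ measurable_fun setT X, measurable_fun setT Y
    & forall A : set R, measurable A -> pushforward P X A = pushforward Q Y A].

(* A real random variable with law Bern(q): the law of the {0,1}-valued variable
   [b] under the Bernoulli measure on [bool]. *)
Definition is_Bern (d : measure_display) (T : measurableType d)
    (R : realType) (P : probability T R) (xi : T -> R) (q : R) : Prop :=
  eq_law P (bernoulli_prob q) xi (fun b : bool => b%:R).

(* Convergence in probability to a constant; the sample space may change
   with n. *)
Definition cvg_in_prob (R : realType) (d : nat -> measure_display)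
    (T : forall n, measurableType (d n)) (P : forall n, probability (T n) R)
    (X : forall n, T n -> R) (c : R) : Prop :=
  (forall n, measurable_fun setT (X n)) /\
  forall eps : R, 0 < eps ->
    P n [set w | eps <= `|X n w - c|] @[n --> \oo] --> 0%E.

(* Main.v *)
Require Import Defs.
From mathcomp Require Import all_boot all_order all_algebra all_fingroup.
From mathcomp Require Import all_classical all_reals all_analysis.
From mathcomp Require Import cyclic measurable_realfun mxtens ring.

(** The butterfly group acts freely on the [N = p ^ n] indices.  In mixed
radix coordinates a Kronecker product acts digit by digit, so one fixed index
yields a fixed digit for every factor; a power of the [p]-cycle fixing a digit
is the identity, hence so is every factor ([butterfly_semiregular]).

Freeness gives everything else.  All cycles of an element [s] of a freely
acting group have length the order of [s] ([card_porbits_semiregular]).  Since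
the factors have exponent [p] and [p] is prime, a non-identity butterfly
permutation has order [p], hence [N / p] cycles ([ncycles_butterfly]), while
the identity has [N].  Freeness also makes the Kronecker product injective on
tuples of powers of the cycle, so the group has [p ^ n = N] elements
([card_butterfly]).

A uniform element is therefore the identity with probability [1 / N], and the
number of cycles takes two values, [N] with probability [1 / N] and [N / p]
otherwise ([law_uniform_group]); this is the law of
[N / p * (1 + (p - 1) * xi)] for a Bernoulli variable [xi] of parameter
[1 / N].  After rescaling by [p / N] the second value becomes [1], so the
probability of being away from [1] is at most [1 / N], which tends to [0]. *)

Import Order.TTheory GRing.Theory Num.Theory.
Import numFieldNormedType.Exports.
Local Open Scope classical_set_scope.
Local Open Scope ring_scope.

(** The stabiliser of a point in [<[s]>] is trivial, so by the orbit-stabiliser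
formula the cycles of [s] partition the points into blocks of size [#[s]]. *)
Lemma card_porbits_semiregular (T : finType) (G : {group {perm T}})
    (s : {perm T}) :
  (forall t x, t \in G -> t x = x -> t = 1%g) -> s \in G ->
  (#|porbits s| * #[s]%g = #|T|)%N.
Proof.
move=> freeG sG.
have sporb : porbits s = [set orbit 'P%act <[s]>%g x | x in [set: T]]%SET.
  apply/setP => A; apply/imsetP/imsetP => -[x _ ->]; exists x => //;
    by rewrite porbitE.
rewrite sporb -cardsT; apply/esym/card_uniform_partition; last first.
  by apply: orbit_partition; apply/actsP => a _ x; rewrite !inE.
move=> _ /imsetP[x _ ->]; rewrite -[RHS](card_orbit_stab 'P%act <[s]>%G x).
suff -> : 'C_<[s]>[x | 'P]%g = 1%g by rewrite cards1 muln1.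
apply/trivgP/fintype.subsetP => t; rewrite inE => /andP[ts].
move/astab1P => /= tx; apply/set1P; apply: (freeG t x) => //.
by move: t ts {tx}; apply/fintype.subsetP; rewrite cycle_subG.
Qed.

Lemma tau_expE p i (k : 'I_p) : (tau p ^+ i)%g k = ((k + i) %% p)%N :> nat.
Proof.
elim: i => [|i IHi]; first by rewrite expg0 perm1 addn0 modn_small.
by rewrite expgSr permM permE /= IHi -addn1 modnDml addn1 addnS.
Qed.

Lemma tau_exp_fix p i (k : 'I_p) : ((tau p ^+ i)%g k = k) <-> (p %| i)%N.
Proof.
split=> [/(congr1 val) /= | pi].
  rewrite tau_expE -[RHS](modn_small (ltn_ord k)) => /eqP.
  by rewrite -{2}[val k]addn0 eqn_modDl mod0n.
apply/val_inj; rewrite /= tau_expE -modnDmr.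
by rewrite (eqP pi) addn0 modn_small.
Qed.

Lemma cycle_tau_semiregular p (t : {perm 'I_p}) (k : 'I_p) :
  t \in <[tau p]>%g -> t k = k -> t = 1%g.
Proof.
case/cycleP=> i -> /tau_exp_fix pi; apply/permP => j; rewrite perm1.
exact/tau_exp_fix.
Qed.

Lemma order_tau p : (0 < p)%N -> #[tau p]%g = p.
Proof.
move=> p0; apply/eqP; rewrite eqn_dvd; apply/andP; split.
  rewrite cyclic.order_dvdn; apply/eqP/permP => k; rewrite perm1.
  exact/tau_exp_fix.
by apply/(@tau_exp_fix p _ (Ordinal p0)); rewrite expg_order perm1.
Qed.

(** Reading an index in base [p], the factor [s j] moves only the [j]-th digit. *)
Lemma kron_prod_fix p n (s : 'I_n -> {perm 'I_p}) (k : 'I_(p ^ n)) :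
  kron_prod s k = k -> forall j, exists i, s j i = i.
Proof.
elim: n s k => [|n IHn] s k; first by move=> _ [].
rewrite /= cast_permE esymK.
move/(congr1 (cast_ord (expnS p n))); rewrite cast_ordKV.
move: (cast_ord _ k) => l {k}; case: (mxtens_indexP l) => i k.
rewrite permE /kron_fun mxtens_indexK.
move/(can_inj (@mxtens_indexK _ _)) => [si sk] j.
case: (unliftP ord0 j) => [j' ->|->]; last by exists i.
exact: (IHn _ _ sk).
Qed.

Lemma butterfly_semiregular p n (t : {perm 'I_(p ^ n)}) k :
  t \in butterfly p n -> t k = k -> t = 1%g.
Proof.
case/imsetP => s; rewrite inE => /forallP sB -> /kron_prod_fix sfix.
rewrite -(kron_prod1 p n); apply: eq_kron_prod => j.
by have [i] := sfix j; apply: cycle_tau_semiregular.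
Qed.

Lemma kron_prodX p n (s : 'I_n -> {perm 'I_p}) m :
  (kron_prod s ^+ m)%g = kron_prod (fun j => s j ^+ m)%g.
Proof.
elim: m => [|m IHm]; first exact/esym/kron_prod1.
rewrite expgS IHm -kron_prodM; apply: eq_kron_prod => j; exact/esym/expgS.
Qed.

Lemma butterfly_expg p n (t : {perm 'I_(p ^ n)}) :
  (0 < p)%N -> t \in butterfly p n -> (t ^+ p = 1)%g.
Proof.
move=> p0 /imsetP[s]; rewrite inE => /forallP sB ->.
rewrite kron_prodX -(kron_prod1 p n); apply: eq_kron_prod => j.
apply/eqP; rewrite -cyclic.order_dvdn -[X in (_ %| X)%N](order_tau p p0).
exact: order_dvdG.
Qed.

(** Two families with the same product differ by a family whose product is the
identity, which has fixed points; freeness of each factor then forces the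
families to agree. *)
Lemma card_butterfly p n : (0 < p)%N -> #|butterfly p n| = (p ^ n)%N.
Proof.
move=> p0; rewrite card_in_imset => [|s t].
  have <- : #|ffun_on_mem 'I_n (mem <[tau p]>%g)| = (p ^ n)%N.
    by rewrite card_ffun_on card_ord; congr (_ ^ _)%N; exact: order_tau.
  apply: eq_card => s; rewrite !inE; exact/forallP/ffun_onP.
rewrite !inE => /forallP sB /forallP tB st.
have k : 'I_(p ^ n) by exists 0%N; rewrite expn_gt0 p0.
have st1 : kron_prod (fun j => s j * (t j)^-1)%g k = k.
  suff -> : kron_prod (fun j => s j * (t j)^-1)%g = 1%g by rewrite perm1.
  apply: (mulIg (kron_prod t)); rewrite mul1g -kron_prodM -st.
  by apply: eq_kron_prod => j; rewrite mulgKV.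
apply/ffunP => j; have [i ji] := kron_prod_fix _ _ _ _ st1 j.
apply: (mulIg (t j)^-1%g); rewrite mulgV.
by apply: (cycle_tau_semiregular _ _ i) => //; rewrite groupM ?groupV.
Qed.

Lemma ncycles1 m : ncycles (1%g : {perm 'I_m}) = m.
Proof.
have := @card_porbits_semiregular _ 1%G (1%g : {perm 'I_m}).
rewrite order1 muln1 card_ord; apply=> // t x /set1P -> //.
Qed.

Lemma ncycles_butterfly p n (s : {perm 'I_(p ^ n)}) :
  prime p -> s \in butterfly p n -> s != 1%g -> (ncycles s * p = p ^ n)%N.
Proof.
move=> pp sB s1; rewrite -[RHS]card_ord.
rewrite -(@card_porbits_semiregular _ (butterfly_group p n) s) //.
  congr (_ * _)%N; apply/esym/(nt_prime_order pp) => //.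
  exact: butterfly_expg (prime_gt0 pp) sB.
exact: butterfly_semiregular.
Qed.

(** The uniform law is given on single permutations; finite additivity turns it
into a count of favourable cases. *)
Lemma uniform_on_count {R : realType} {d} {T : measurableType d}
    (P : probability T R) m (X : {RV P >-> {perm 'I_m}}) B
    (D : set {perm 'I_m}) :
  uniform_on X B ->
  P (X @^-1` D) = (#|[set s in B | `[< D s >]]%SET|%:R / #|B|%:R)%:E.
Proof.
move=> XB.
pose r := enum [pred s | `[< D s >]].
have rD : D = [set` r].
  by apply/seteqP; split => s /=; rewrite mem_enum inE.
have mX (A : set {perm 'I_m}) : measurable (X @^-1` A).
  by rewrite -[_ @^-1` _]setTI; exact: measurable_funPT.
have -> : X @^-1` D = \bigcup_(s in D) X @^-1` [set s].
  by apply/seteqP; split => [w Dw|w [s Ds Xs]]; [exists (X w) | rewrite /= Xs].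
have finD : finite_set D by rewrite rD; exact: finite_seq.
rewrite measure_fin_bigcup //; last first.
  by apply/trivIsetP => s t _ _ /eqP st; apply/seteqP; split => w //= [Xs Xt];
    apply: st; rewrite -Xs -Xt.
rewrite [in LHS]rD -fsbig_seq ?enum_uniq // (eq_bigr _ (fun s _ => XB s)).
rewrite big_enum /= sumEFin -big_mkcondr /= sumr_const.
rewrite mulr_natl; congr (_%:E); congr (_ *+ _).
rewrite cardsE; apply: eq_card => s; exact: andbC.
Qed.

(** The form of the right-hand side is that of a Bernoulli law of parameter
[1 / #|G|] pushed forward to the two values. *)
Lemma law_uniform_group {R : realType} {d} {T : measurableType d}
    (P : probability T R) m (X : {RV P >-> {perm 'I_m}})
    (G : {group {perm 'I_m}}) (f : {perm 'I_m} -> R) (v : R) :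
  uniform_on X G -> (forall s, s \in G -> s != 1%g -> f s = v) ->
  forall A : set R, P [set w | A (f (X w))] =
    (#|G|%:R^-1%:E * \d_(f 1%g) A + (1 - #|G|%:R^-1)%:E * \d_v A)%E.
Proof.
move=> XG fv A; rewrite (uniform_on_count _ _ _ _ (f @^-1` A) XG).
rewrite (cardsD1 1%g) inE group1 /= !diracE -!EFinM -EFinD; congr (_%:E).
rewrite natrD.
have G0 : #|G|%:R != 0 :> R by rewrite pnatr_eq0 -lt0n cardG_gt0.
have -> : #|([set s in G | `[< A (f s) >]] :\ 1%g)%SET|%:R =
    (#|G|%:R - 1) * (v \in A)%:R :> R.
  have [vA|vA] := boolP (v \in A).
    have -> : ([set s in G | `[< A (f s) >]] :\ 1%g)%SET = (G :\ 1%g)%SET.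
      apply/setP => s; rewrite !inE; have [//|s1] := eqVneq s 1%g.
      have [sG|//] := boolP (s \in G); rewrite /=.
      by apply/asboolP; rewrite /= (fv s) //; exact: set_mem.
    by rewrite [in RHS](cardsD1 1%g G) group1 natrD mulr1 addrC addKr.
  rewrite (_ : _ :\ _ = finset.set0)%SET ?cards0 ?mulr0//.
  apply/setP => s; rewrite !inE; apply/negP => /and3P[s1 sG /asboolP].
  by rewrite /= (fv s) // => /mem_set; apply/negP.
have -> : `[< A (f 1%g) >] = (f 1%g \in A) by [].
by field.
Qed.

Lemma measurable_perm_discrete {R : realType} {d} {T : measurableType d}
    (P : probability T R) m (X : {RV P >-> {perm 'I_m}})
    (f : {perm 'I_m} -> R) : measurable_fun setT (fun w => f (X w)).
Proof. exact: (@measurableT_comp _ _ _ _ _ _ f). Qed.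

Theorem theorem9 (R : realType) (p : nat) (p_prime : prime p)
    (d : nat -> measure_display) (T : forall n : nat, measurableType (d n))
    (P : forall n : nat, probability (T n) R)
    (sigma : forall n : nat, {RV (P n) >-> {perm 'I_(p ^ n)}})
    (sigma_unif : forall n : nat, (1 <= n)%N ->
       uniform_on (sigma n) (butterfly p n)) :
  (forall n : nat, (1 <= n)%N ->
     forall (d' : measure_display) (T' : measurableType d')
       (Q : probability T' R) (xi : T' -> R),
     is_Bern Q xi ((p ^ n)%:R^-1) ->
     eq_law (P n) Q
       (fun w => (ncycles (sigma n w))%:R)
       (fun w' => (p ^ n)%:R / p%:R * (1 + (p%:R - 1) * xi w')))
  /\ cvg_in_prob P
       (fun n w => p%:R / (p ^ n)%:R * (ncycles (sigma n w))%:R) 1.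
Proof.
have p0 := prime_gt0 p_prime.
have pR0 : p%:R != 0 :> R by rewrite pnatr_eq0 -lt0n.
have N0 n : (p ^ n)%:R != 0 :> R by rewrite pnatr_eq0 -lt0n expn_gt0 p0.
have ncR n s : s \in butterfly p n -> s != 1%g ->
    (ncycles s)%:R = (p ^ n)%:R / p%:R :> R.
  move=> sB s1; apply/(canRL (mulfK pR0)).
  by rewrite -natrM ncycles_butterfly.
split=> [n n1 d' T' Q xi [mxi mb xiQ]|]; split.
- exact: (measurable_perm_discrete _ _ _ (fun s => (ncycles s)%:R)).
- by apply: measurable_funM => //; apply: measurable_funD => //;
    apply: measurable_funM.
- move=> A mA; rewrite /pushforward.
  have := law_uniform_group (P n) _ (sigma n) (butterfly_group p n)
    (fun s => (ncycles s)%:R) _ (sigma_unif n n1) (ncR n) A.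
  rewrite /= card_butterfly // ncycles1 => ->.
  (* Both sides are two-point laws: [g 1] and [g 0] are the two cycle counts. *)
  pose g (x : R) := (p ^ n)%:R / p%:R * (1 + (p%:R - 1) * x).
  have mg : measurable_fun setT g.
    by apply: measurable_funM => //; apply: measurable_funD => //;
      apply: measurable_funM.
  have mgA : measurable (g @^-1` A) by rewrite -[_ @^-1` _]setTI; exact: mg.
  rewrite -[RHS]/(pushforward Q xi (g @^-1` A)) xiQ // /pushforward.
  pose q : R := (p ^ n)%:R^-1.
  have q01 : 0 <= q <= 1.
    by rewrite invr_ge0 ler0n invf_le1 ?ler1n ?ltr0n ?expn_gt0 ?p0.
  rewrite [RHS](bernoulli_probE q01).
  rewrite !diracE; congr (_ * (_ %:R)%:E + _ * (_%:R)%:E)%E.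
    have <- : g 1 = (p ^ n)%:R by rewrite /g mulr1 addrC subrK mulfVK.
    by [].
  have <- : g 0 = (p ^ n)%:R / p%:R by rewrite /g mulr0 addr0 mulr1.
  by [].
- by move=> n; apply: (measurable_perm_discrete _ _ _
    (fun s => p%:R / (p ^ n)%:R * (ncycles s)%:R)).
- move=> eps eps0.
  apply: (@squeeze_cvge _ _ _ _ (cst 0%E) _ (fun n => (p ^ n)%:R^-1%:E)).
  + near=> n; rewrite measure_ge0 /=.
    have n1 : (1 <= n)%N by near: n; exact: nbhs_infty_ge.
    pose A := [set x : R | eps <= `|x - 1|].
    have := law_uniform_group (P n) _ (sigma n) (butterfly_group p n)
      (fun s => p%:R / (p ^ n)%:R * (ncycles s)%:R) 1 (sigma_unif n n1) _ A.
    rewrite /= => -> => [|s sB s1]; last first.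
      by rewrite (ncR n) // mulrA mulfVK // divff.
    (* The rescaled count of a non-identity element is exactly 1, outside [A]. *)
    have -> : \d_(1%R : R) A = 0%E :> \bar R.
      rewrite diracE memNset // /A /= subrr normr0; apply/negP.
      by rewrite -ltNge.
    rewrite mule0 adde0 card_butterfly // diracE -EFinM lee_fin.
    by rewrite ler_piMr ?invr_ge0 ?ler0n //; case: (_ \in _); rewrite ?ler01.
  + exact: cvg_cst.
  + under eq_fun do rewrite natrX -exprVn.
    apply: cvg_EFin; first by near=> n.
    apply: cvg_expr; rewrite normfV normr_nat invf_lt1 ?ltr0n //.
    by rewrite ltr1n prime_gt1.
Unshelve. all: by end_near.
Qed.
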